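(* Suppose $k\ge 3$ and $n\ge 3$ is odd. Then (for any of the choices made in its construction) $Z_k(n)$ is an Eulerian subgraph of the de Bruijn digraph $B_k(n)$, and there exists a maximal $\mathcal{NAS}_k(n+1)$.
   Context: Sequences. For a sequence $S=(s_i)_{i\ge0}$ over $\mathbb{Z}_k$ write $\mathbf{s}_r(i)=(s_i,\dots,s_{i+r-1})$; an $r$-tuple occurs in $S$ if it equals some $\mathbf{s}_r(i)$. A $k$-ary $r$-window sequence is a periodic sequence over $\mathbb{Z}_k$, of period $m$ say, such that $\mathbf{s}_r(i)=\mathbf{s}_r(j)$ implies $i\equiv j\pmod m$. For $k\ge3$, $r\ge2$, an $\mathcal{NAS}_k(r)$ is a $k$-ary $r$-window sequence such that whenever an $r$-tuple $\mathbf{a}$ occurs in it, $-\mathbf{a}$ (entrywise negation) does not. It is maximal if its period is $\frac{k^r-1}{2}$ ($k$ odd) or $\frac{k^r-2^r}{2}$ ($k$ even). Graphs. For $r\ge1$, $B_k(r)$ is the digraph on $\mathbb{Z}_k^r$ with an edge from $(x_0,\dots,x_{r-1})$ to $(x_1,\dots,x_{r-1},y)$ for all $x_i,y$; this edge is identified with the $(r+1)$-tuple $(x_0,\dots,x_{r-1},y)$. A digraph is Eulerian if it is connected and every vertex has in-degree equal to out-degree. The graph $W_k(n-1)$. Let $f:\mathbb{Z}_k\to\mathbb{Q}$ be $f(u)=u$ (as an integer in $[1,k-1]$) for $u\ne0$ and $f(0)=k/2$; the pseudoweight of $\mathbf{u}=(u_0,\dots,u_{n-1})$ is $w^*(\mathbf{u})=\sum_i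 f(u_i)\in\mathbb{Q}$. Let $E_k(n)$ be the set of $k$-ary $n$-tuples with pseudoweight less than $nk/2$. For an $n$-tuple $(a_0,\dots,a_{n-1})$, the circuit $[a_0,\dots,a_{n-1}]$ in $B_k(n-1)$ consists of the edges given by all distinct cyclic rotations of $(a_0,\dots,a_{n-1})$. A tuple is self-negative if it equals its negative; a circuit is self-negative if its tuples are. Let $\mathcal{C}^*_k(n-1)$ be the set of non-self-negative circuits $[a_0,\dots,a_{n-1}]$ with $w^*(a_0,\dots,a_{n-1})=kn/2$. For $n$ odd these circuits come in pairs consisting of a circuit and its (distinct) negative. Choose one circuit from each pair; let $F_k(n)$ be the union of $E_k(n)$ and the set of all $n$-tuples in the chosen circuits, and let $W_k(n-1)$ be the subgraph of $B_k(n-1)$ with edge set $F_k(n)$ and vertices those incident with these edges. The Lempel homomorphism. $D(a_0,\dots,a_{r-1})=(a_1-a_0,\dots,a_{r-1}-a_{r-2})$ maps vertices and edges of $B_k(n)$ to those of $B_k(n-1)$; $D^{-1}(W_k(n-1))$ is the subgraph of $B_k(n)$ consisting of all edges and vertices mapped by $D$ to edges and vertices of $W_k(n-1)$. The circuits $\mathbf{b}_x$, $x\in\mathbb{Z}_k$. If $k$ is odd, $\mathbf{b}_x$ is the circuit of $B_k(n)$ consisting of the single edge (loop) given by the $(n+1)$-tuple $(x,x,\dots,x)$. If $k$ is even, let $T_k(n-1)$ be the subgraph of $B_k(n-1)$ whose edges are the $2^n$ $n$-tuples with all entries in $\{0,k/2\}$ (with the vertices on these edges), and fix an Eulerian circuit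 of it, i.e. a cyclic sequence $[a_0,\dots,a_{2^n-1}]$ with entries in $\{0,k/2\}$ in which every $n$-tuple over $\{0,k/2\}$ occurs exactly once (cyclically). Put $b_i=\sum_{j=0}^i a_j\in\mathbb{Z}_k$, so that $b_{2^n-1}=0$; then $\mathbf{b}_x$ is the circuit in $B_k(n)$ whose edges are the $2^n$ $(n+1)$-tuples of cyclically consecutive terms of the cyclic sequence $[x+b_0,x+b_1,\dots,x+b_{2^n-2},x]$. The graph $Z_k(n)$ is the subgraph of $B_k(n)$ whose edges are the edges of $D^{-1}(W_k(n-1))$ together with the edges of $\mathbf{b}_x$ for all integers $x$ with $0<x<k/2$ (and whose vertices are those on these edges). *)

(* Defs.v *)
From HB Require Import structures.
From mathcomp Require Import all_boot all_order all_algebra.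
Set Implicit Arguments.
Unset Strict Implicit.
Unset Printing Implicit Defensive.
Import Order.TTheory GRing.Theory Num.Theory.
Local Open Scope ring_scope.

(* 'Z_k is the ring of integers modulo k only for 1 < k; everything below is
   meant for k >= 3. *)

Definition negt (k n : nat) (t : n.-tuple 'Z_k) : n.-tuple 'Z_k :=
  [tuple of map -%R t].

Definition window (k : nat) (s : nat -> 'Z_k) (r i : nat) : r.-tuple 'Z_k :=
  [tuple s (i + j)%N | j < r].

Definition occurs (k r : nat) (s : nat -> 'Z_k) (t : r.-tuple 'Z_k) : Prop :=
  exists i : nat, window s r i = t.

(* The window property forces m to be the least period of s. *)
Definition window_sequence (k r m : nat) (s : nat -> 'Z_k) : Prop :=
  [/\ (0 < m)%N,
      forall i : nat, s (i + m)%N = s i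
    & forall i j : nat, window s r i = window s r j -> i = j %[mod m]].

Definition NAS (k r m : nat) (s : nat -> 'Z_k) : Prop :=
  window_sequence r m s /\
  forall t : r.-tuple 'Z_k, occurs s t -> ~ occurs s (negt t).

Definition max_period (k r : nat) : nat :=
  if odd k then ((k ^ r - 1) %/ 2)%N else ((k ^ r - 2 ^ r) %/ 2)%N.

Definition maximal_NAS (k r : nat) (s : nat -> 'Z_k) : Prop :=
  NAS r (max_period k r) s.

(* The de Bruijn digraph B_k(n-1) and its subgraphs are indexed by the length n
   of their edges: an edge is an n-tuple, going from its first n-1 entries to
   its last n-1 entries. *)
Record bgraph (k n : nat) := BGraph {
  verts : {set n.-1.-tuple 'Z_k};
  edges : {set n.-tuple 'Z_k}
}.

Definition src (k n : nat) (e : n.-tuple 'Z_k) : n.-1.-tuple 'Z_k :=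
  [tuple e`_i | i < n.-1].

Definition tgt (k n : nat) (e : n.-tuple 'Z_k) : n.-1.-tuple 'Z_k :=
  [tuple e`_i.+1 | i < n.-1].

Definition deBruijn (k r : nat) : bgraph k r.+1 := BGraph setT setT.

Definition subgraph (k n : nat) (G H : bgraph k n) : Prop :=
  [/\ verts G \subset verts H,
      edges G \subset edges H
    & forall e, e \in edges G -> src e \in verts G /\ tgt e \in verts G].

Definition edge_graph (k n : nat) (E : {set n.-tuple 'Z_k}) : bgraph k n :=
  BGraph ((@src k n @: E) :|: (@tgt k n @: E)) E.

Definition adj (k n : nat) (G : bgraph k n) : rel (n.-1.-tuple 'Z_k) :=
  fun u v => [exists e in edges G, (src e == u) && (tgt e == v)].

(* Connectedness of a digraph is that of its underlying undirected graph. *)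
Definition connected (k n : nat) (G : bgraph k n) : Prop :=
  forall u v, u \in verts G -> v \in verts G ->
    connect (fun x y => adj G x y || adj G y x) u v.

Definition indeg (k n : nat) (G : bgraph k n) (v : n.-1.-tuple 'Z_k) : nat :=
  #|[set e in edges G | tgt e == v]|.

Definition outdeg (k n : nat) (G : bgraph k n) (v : n.-1.-tuple 'Z_k) : nat :=
  #|[set e in edges G | src e == v]|.

Definition eulerian (k n : nat) (G : bgraph k n) : Prop :=
  connected G /\ forall v, v \in verts G -> indeg G v = outdeg G v.

Definition pweight1 (k : nat) (u : 'Z_k) : rat :=
  if u == 0 then k%:R / 2 else (u : nat)%:R.

Definition pweight (k n : nat) (t : n.-tuple 'Z_k) : rat :=
  \sum_(i < n) pweight1 (tnth t i).

Definition Eset (k n : nat) : {set n.-tuple 'Z_k} :=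
  [set t | pweight t < (n * k)%N%:R / 2].

Definition circuit (k n : nat) (a : n.-tuple 'Z_k) : {set n.-tuple 'Z_k} :=
  [set [tuple of rot i a] | i : 'I_n].

Definition neg_circuit (k n : nat) (C : {set n.-tuple 'Z_k}) :
  {set n.-tuple 'Z_k} := @negt k n @: C.

Definition self_negative (k n : nat) (t : n.-tuple 'Z_k) : bool := t == negt t.

Definition self_negative_circuit (k n : nat) (C : {set n.-tuple 'Z_k}) : bool :=
  [forall t in C, self_negative t].

Definition Cstar (k n : nat) : {set {set n.-tuple 'Z_k}} :=
  [set circuit a | a : n.-tuple 'Z_k
     & (pweight a == (k * n)%N%:R / 2) && ~~ self_negative_circuit (circuit a)].

(* P contains exactly one circuit of each pair {C, -C} in Cstar k n. *)
Definition circuit_choice (k n : nat) (P : {set {set n.-tuple 'Z_k}}) : Prop :=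
  P \subset Cstar k n /\
  forall C, C \in Cstar k n -> (C \in P) (+) (neg_circuit C \in P).

Definition Fset (k n : nat) (P : {set {set n.-tuple 'Z_k}}) :
  {set n.-tuple 'Z_k} := Eset k n :|: cover P.

Definition Wgraph (k n : nat) (P : {set {set n.-tuple 'Z_k}}) : bgraph k n :=
  edge_graph (Fset P).

Definition Lempel (k r : nat) (a : r.-tuple 'Z_k) : r.-1.-tuple 'Z_k :=
  [tuple a`_i.+1 - a`_i | i < r.-1].

Definition Lempel_preim (k n : nat) (G : bgraph k n) : bgraph k n.+1 :=
  @BGraph k n.+1
         [set v : n.-tuple 'Z_k | Lempel v \in verts G]
         [set e : n.+1.-tuple 'Z_k | Lempel e \in edges G].

Definition cwindow (k m : nat) (a : m.-tuple 'Z_k) (r i : nat) :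
  r.-tuple 'Z_k := [tuple a`_((i + j) %% m)%N | j < r].

Definition in_0half (k : nat) (x : 'Z_k) : bool :=
  (x == 0) || (x == (k %/ 2)%N%:R).

(* a, read cyclically, is an Eulerian circuit of T_k(n-1); used for k even. *)
Definition T_circuit (k n : nat) (a : (2 ^ n)%N.-tuple 'Z_k) : Prop :=
  all (@in_0half k) a /\
  forall t : n.-tuple 'Z_k, all (@in_0half k) t ->
    exists! i : 'I_(2 ^ n), cwindow a n i = t.

Definition bseq (k n : nat) (a : (2 ^ n)%N.-tuple 'Z_k) (x : 'Z_k) :
  (2 ^ n)%N.-tuple 'Z_k :=
  [tuple x + \sum_(j < i.+1) a`_j | i < (2 ^ n)%N].

(* For k odd, a is not used. *)
Definition bcircuit (k n : nat) (a : (2 ^ n)%N.-tuple 'Z_k) (x : 'Z_k) :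
  {set n.+1.-tuple 'Z_k} :=
  if odd k then [set [tuple x | _ < n.+1]]
  else [set cwindow (bseq a x) n.+1 i | i : 'I_(2 ^ n)].

Definition Zgraph (k n : nat) (P : {set {set n.-tuple 'Z_k}})
    (a : (2 ^ n)%N.-tuple 'Z_k) : bgraph k n.+1 :=
  edge_graph (edges (Lempel_preim (Wgraph P)) :|:
              \bigcup_(x < k | (0 < x)%N && (x.*2 < k)%N)
                 bcircuit a (x : nat)%:R).

(* Main.v *)
Require Import Defs.
From mathcomp Require Import all_boot all_order all_fingroup all_algebra.
From mathcomp Require Import zify lra.
Set Implicit Arguments.
Unset Strict Implicit.
Unset Printing Implicit Defensive.
Import Order.TTheory GRing.Theory Num.Theory.

(* F_k(n) is closed under rotation, so D^{-1}(W_k(n-1)) has equal in- and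
   out-degrees, and Z_k(n) adds to it disjoint circuits. Every edge of Z_k(n)
   has Lempel image of pseudoweight at most nk/2; walking on by always adding 1
   to the last entry lowers this pseudoweight or rotates the image, so the walk
   stays in Z_k(n) and ends in the arithmetic progressions of step 1, all of
   which lie on one circuit. Hence Z_k(n) is connected.
   Since D commutes with negation, Z_k(n) contains exactly one of e and -e for
   each non-self-negative (n+1)-tuple e: this is the choice of F_k(n) when D(e)
   is not self-negative, and otherwise e lies on a single circuit x + b, for
   which 0 < x < k/2 or 0 < -x < k/2. Reading off an Eulerian circuit of Z_k(n)
   gives the sequence. *)

(** * Eulerian circuits as cyclic permutations of edges *)

Lemma perm_of_equal_fibers (E V : finType) (f g : E -> V) :
  (forall v, #|[set e | g e == v]| = #|[set e | f e == v]|) ->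
  exists p : {perm E}, forall e, f (p e) = g e.
Proof.
move=> card_fg.
pose fib (h : E -> V) v := enum [set e | h e == v].
(* The element at a given place in the enumeration of a fibre of [g] goes to the element at the same
   place in the corresponding fibre of [f]. *)
pose q e := nth e (fib f (g e)) (index e (fib g (g e))).
have lt_idx e : index e (fib g (g e)) < size (fib f (g e)).
  by rewrite -cardE -card_fg cardE index_mem mem_enum inE.
have fq e : f (q e) = g e.
  by have := mem_nth e (lt_idx e); rewrite mem_enum inE => /eqP.
have q_inj : injective q.
  move=> e1 e2 eq12; have eqg : g e1 = g e2 by rewrite -!fq eq12.
  move: eq12; rewrite /q (set_nth_default e2) // -eqg => /eqP.
  rewrite nth_uniq ?enum_uniq ?lt_idx //; last by rewrite eqg lt_idx.
  move/eqP; apply: index_inj; rewrite ?mem_enum ?inE ?eqg //.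
by exists (perm q_inj) => e; rewrite permE.
Qed.

(** A permutation sending each edge to a successor splits the edges into closed trails. One with the
    fewest orbits is a single trail, since edges with a common head in different orbits would allow
    two trails to be joined. *)
Lemma eulerian_perm (E V : finType) (src tgt : E -> V) :
  (forall v, #|[set e | tgt e == v]| = #|[set e | src e == v]|) ->
  (forall e1 e2, connect
     (fun x y => [exists e, (src e == x) && (tgt e == y)]
              || [exists e, (src e == y) && (tgt e == x)]) (tgt e1) (tgt e2)) ->
  exists p : {perm E},
    (forall e, src (p e) = tgt e) /\ forall e1 e2, e2 \in porbit p e1.
Proof.
move=> bal conn.
have [p0 p0P] := perm_of_equal_fibers bal.
have p0b : [forall e, src (p0 e) == tgt e] by apply/forallP=> e; rewrite p0P.
pose trail (p : {perm E}) := [forall e, src (p e) == tgt e].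
case: (@arg_minnP _ p0 trail (fun p => #|porbits p|) p0b).
move=> p /forallP pP minp.
have {}pP e : src (p e) = tgt e by apply/eqP.
exists p; split=> // e1 e2.
(* Swapping the successors of two edges with the same head merges their orbits. *)
have merge e e' : tgt e = tgt e' -> e \in porbit p e'.
  move=> eqt; apply: contraT => ne.
  have /minp : trail (tperm e e' * p)%g.
    apply/forallP=> x; rewrite permM pP; by case: tpermP => [->|->|]; rewrite ?eqt.
  have neq : e != e' by apply: contraNneq ne => ->; rewrite porbit_id.
  move=> /=; have := porbits_mul_tperm p e e'; rewrite /= ne neq addn1 addn2 => -[<-].
  by rewrite ltnn.
(* The edge [p^-1 e] has head [src e], so [merge] applies to it and [e']. *)
have pred_orbit e e' : tgt e' = src e -> (e' \in porbit p e).
  rewrite -{1}[e](permKV p) pP => /merge; rewrite porbit_sym porbit_sym.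
  by rewrite -{2}[e](permKV p) -(expg1 p) porbit_perm.
have trans e e' e'' : e' \in porbit p e -> e'' \in porbit p e' -> e'' \in porbit p e.
  by rewrite -!eq_porbit_mem => /eqP -> /eqP ->.
case/connectP: (conn e1 e2) => s.
have sorb e e' : e \in porbit p e' -> e' \in porbit p e by rewrite porbit_sym.
elim: s e1 => [|v s IHs] e1 /=; first by move=> _; apply: merge.
set x := tgt e1.
case/andP=> /orP [] /existsP [e /andP [/eqP se /eqP te]].
  move=> ps ls; apply: (trans _ e); last by apply: IHs; rewrite te.
  by apply: sorb; apply: pred_orbit; rewrite se.
(* Here [e] is crossed backwards: it shares its head with [e1], and its predecessor in the orbit has
   the required head [v]. *)
move=> ps ls.
have te' : tgt (p^-1%g e) = v by rewrite -pP permKV.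
apply: (trans _ (p^-1%g e)); last by apply: IHs; rewrite te'.
apply: (trans _ e); first exact: merge.
by apply: pred_orbit; rewrite te' se.
Qed.

(** * Windows, and sequences read off Eulerian circuits *)

Lemma eq_from_nth0 k n (t u : n.-tuple 'Z_k) :
  (forall i, (i < n)%N -> t`_i = u`_i)%R -> t = u.
Proof.
move=> eq_tu; apply/val_inj/(@eq_from_nth _ 0%R); first by rewrite !size_tuple.
by move=> i; rewrite size_tuple; apply: eq_tu.
Qed.

Lemma nth_tuple_of k n (F : 'I_n -> 'Z_k) i (lt_in : i < n) :
  ([tuple F j | j < n]`_i)%R = F (Ordinal lt_in).
Proof. exact: (nth_mktuple F 0%R (Ordinal lt_in)). Qed.

Lemma nth_src k n (e : n.+1.-tuple 'Z_k) i : i < n -> ((src e)`_i = e`_i)%R.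
Proof. by move=> lt_in; rewrite /src nth_tuple_of. Qed.

Lemma nth_tgt k n (e : n.+1.-tuple 'Z_k) i : i < n -> ((tgt e)`_i = e`_i.+1)%R.
Proof. by move=> lt_in; rewrite /tgt nth_tuple_of. Qed.

Lemma nth_window k (s : nat -> 'Z_k) r i j :
  j < r -> ((window s r i)`_j = s (i + j)%N)%R.
Proof. by move=> lt_jr; rewrite /window nth_tuple_of. Qed.

(** The condition ranges over all tuples, not only the vertices of the graph, so it is additive over
    disjoint unions of edge sets. *)
Definition balanced k n (E : {set n.-tuple 'Z_k}) : Prop :=
  forall v, indeg (edge_graph E) v = outdeg (edge_graph E) v.

(** The sequence lists the first entries of the edges along an Eulerian circuit. Consecutive edges
    overlap, so its windows are the edges themselves, and each edge is met once per turn. *)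
Lemma eulerian_sequence k n (E : {set n.+1.-tuple 'Z_k}) :
  E != set0 -> eulerian (edge_graph E) ->
  exists s : nat -> 'Z_k,
    [/\ forall i, s (i + #|E|) = s i, forall i, window s n.+1 i \in E
      & forall i j, window s n.+1 i = window s n.+1 j -> i = j %[mod #|E|] ].
Proof.
case/set0Pn=> e0 e0E [conn bal].
pose sT := {e | e \in E}.
have card_sub (f : n.+1.-tuple 'Z_k -> n.+1.-1.-tuple 'Z_k) v :
  #|[set x : sT | f (val x) == v]| = #|[set e in E | f e == v]|.
  rewrite -(card_imset _ val_inj); apply: eq_card => e; rewrite !inE.
  apply/imsetP/andP => [[x + ->]|[eE fe]]; first by rewrite inE (valP x).
  by exists (Sub e eE); rewrite ?inE.
have [||p [pP p1]] := @eulerian_perm sT _ (@src k n.+1 \o val) (@tgt k n.+1 \o val).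
- move=> v; rewrite !card_sub.
  have [vV|vV] := boolP (v \in verts (edge_graph E)); first exact: bal.
  have none (f : n.+1.-tuple 'Z_k -> n.+1.-1.-tuple 'Z_k) :
    v \notin f @: E -> #|[set e in E | f e == v]| = 0.
    move=> nv; apply/eqP; rewrite cards_eq0 -subset0; apply/subsetP => e.
    by rewrite inE => /andP [eE /eqP fe]; rewrite -fe imset_f in nv.
  by move: vV; rewrite inE negb_or => /andP [/none -> /none ->].
- move=> x y.
  have inV (z : sT) : tgt (val z) \in verts (edge_graph E).
    by rewrite inE imset_f ?orbT // (valP z).
  have := conn _ _ (inV x) (inV y); apply: connect_sub => u v uv.
  apply: connect1; case/orP: uv => /exists_inP [e eE uv]; apply/orP; [left|right].
    by apply/existsP; exists (Sub e eE).
  by apply/existsP; exists (Sub e eE).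
pose x0 : sT := Sub e0 e0E.
have cardE : #|porbit p x0| = #|E|.
  by rewrite -[RHS]card_sig; apply: eq_card => x; rewrite inE p1.
pose x_ i := iter i p x0.
pose s i : 'Z_k := ((val (x_ i))`_0)%R.
have sE i : window s n.+1 i = val (x_ i).
  apply: eq_from_nth0 => j; elim: j i => [|j IHj] i ltj; rewrite nth_window //.
    by rewrite addn0.
  (* Entry [j+1] of an edge is entry [j] of the next one, which the induction hypothesis reads off
     the sequence. *)
  have := pP (x_ i); rewrite -iterS -/(x_ _) => /(congr1 (fun t : n.+1.-1.-tuple 'Z_k => t`_j)%R).
  rewrite [LHS]nth_src // [RHS]nth_tgt // => <-.
  by rewrite -IHj ?nth_window ?addSnnS // ltnW.
have x_per i : x_ (i + #|E|) = x_ i by rewrite /x_ iterD -cardE iter_porbit.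
have x_mod i : x_ i = x_ (i %% #|E|).
  rewrite {1}(divn_eq i #|E|) addnC; elim: (i %/ _) => [|q IHq]; rewrite ?addn0 //.
  by rewrite mulSn addnCA addnC x_per.
exists s; split=> [i|i|i j]; first by rewrite /s x_per.
  by rewrite sE (valP (x_ i)).
have E0 : 0 < #|E| by rewrite card_gt0; apply/set0Pn; exists e0.
rewrite !sE => /val_inj; rewrite x_mod [RHS]x_mod => eqx.
have := uniq_traject_porbit p x0; rewrite cardE => /uniqP => /(_ x0 (i %% #|E|) (j %% #|E|)).
rewrite !inE !size_traject !ltn_pmod // !nth_traject ?ltn_pmod //; exact.
Qed.

(** * Criteria for balance and connectedness *)

Lemma balanced_image k n (I : finType) (A : {set I}) (w : I -> n.-tuple 'Z_k)
    (g : I -> I) :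
  {in A &, injective w} -> {in A &, injective g} ->
  {in A, forall i, g i \in A /\ src (w (g i)) = tgt (w i)} ->
  balanced (w @: A).
Proof.
move=> w_inj g_inj gA v.
(* An injective self-map of a finite set is onto, so [g] matches the edges entering [v] with those
   leaving it. *)
have gAA : g @: A = A.
  apply/eqP; rewrite eqEcard card_in_imset // leqnn andbT.
  by apply/subsetP => _ /imsetP [e eE ->]; case: (gA e eE).
have degE f : #|[set e in w @: A | f e == v]| = #|[set i in A | f (w i) == v]|.
  rewrite -(@card_in_imset _ _ w); last first.
    by move=> e e'; rewrite !inE => /andP [eE _] /andP [eE' _]; apply: w_inj.
  apply: eq_card => e; rewrite inE; apply/andP/imsetP => [[/imsetP [i iA ->] fi]|[i + ->]].
    by exists i; rewrite // inE iA.
  by rewrite inE => /andP [iA ->]; rewrite imset_f.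
rewrite /indeg /outdeg /= !degE -[LHS](@card_in_imset _ _ g); last first.
  by move=> e e'; rewrite !inE => /andP [eE _] /andP [eE' _]; apply: g_inj.
apply: eq_card => i; rewrite [RHS]inE; apply/imsetP/andP => [[e' + ->]|[]].
  by rewrite inE => /andP [e'E /eqP <-]; case: (gA _ e'E) => -> ->.
rewrite -{1}gAA => /imsetP [e' e'E ->] /eqP <-; exists e' => //.
by rewrite inE e'E (proj2 (gA _ e'E)) eqxx.
Qed.

Lemma balanced_of_succ k n (E : {set n.-tuple 'Z_k})
    (g : n.-tuple 'Z_k -> n.-tuple 'Z_k) :
  {in E &, injective g} -> {in E, forall e, g e \in E /\ src (g e) = tgt e} ->
  balanced E.
Proof. by move=> g_inj gE; rewrite -[E]imset_id; apply: balanced_image g_inj gE. Qed.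

Lemma balanced_setU k n (A B : {set n.-tuple 'Z_k}) :
  [disjoint A & B] -> balanced A -> balanced B -> balanced (A :|: B).
Proof.
move=> dAB balA balB v.
have card_f (f : n.-tuple 'Z_k -> n.-1.-tuple 'Z_k) :
    #|[set e in A :|: B | f e == v]| =
    #|[set e in A | f e == v]| + #|[set e in B | f e == v]|.
  rewrite -cardsUI [X in _ = _ + #|pred_of_set X|](_ : _ = set0).
    by rewrite cards0 addn0; apply: eq_card => e; rewrite !inE andb_orl.
  apply/setP => e; rewrite !inE; apply/negP => /andP [/andP [eA _] /andP [eB _]].
  by have := disjointFr dAB eA; rewrite eB.
by have := balA v; have := balB v; rewrite /indeg /outdeg /= !card_f => -> ->.
Qed.

Lemma adj_window k n (E : {set n.+1.-tuple 'Z_k}) (s : nat -> 'Z_k) i :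
  window s n.+1 i \in E ->
  adj (edge_graph E) (src (window s n.+1 i)) (src (window s n.+1 i.+1)).
Proof.
move=> sE; apply/exists_inP; exists (window s n.+1 i); rewrite ?eqxx //=.
apply/eqP/eq_from_nth0 => j ltj.
by rewrite nth_tgt // nth_src // !nth_window ?addSnnS // ltnW.
Qed.

(** Adjacency is taken undirected, so it suffices that every edge leads to the common hub [h]; no
    walk back is required. *)
Lemma connected_of_walks k n (E : {set n.+1.-tuple 'Z_k}) h :
  (forall e, e \in E -> exists (s : nat -> 'Z_k) m,
     [/\ window s n.+1 0 = e, window s n.+1 m = h
       & forall i, window s n.+1 i \in E]) ->
  connected (edge_graph E).
Proof.
move=> walks.
set R := fun x y => adj (edge_graph E) x y || adj (edge_graph E) y x.
have symR : connect_sym R by apply: sym_connect_sym => x y; rewrite /R orbC.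
have src_hub e : e \in E -> connect R (src e) (src h).
  case/walks=> s [m [<- <- sE]]; elim: m => [|m IHm]; first exact: connect0.
  by apply: connect_trans IHm _; apply: connect1; rewrite /R adj_window ?sE.
have vert_hub v : v \in verts (edge_graph E) -> connect R v (src h).
  rewrite inE => /orP [] /imsetP [e eE ->]; first exact: src_hub.
  apply: connect_trans (src_hub e eE); apply: connect1; apply/orP; right.
  by apply/exists_inP; exists e; rewrite ?eqxx.
move=> u v /vert_hub uh /vert_hub; rewrite symR; exact: connect_trans uh.
Qed.

Lemma balanced_eulerian k n (E : {set n.-tuple 'Z_k}) :
  balanced E -> connected (edge_graph E) -> eulerian (edge_graph E).
Proof. by move=> balE connE; split=> // v _; apply: balE. Qed.

(** * Pseudoweight and negation *)

Lemma val_Zopp k (u : 'Z_k) : 1 < k -> val (- u)%R = (k - u) %% k.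
Proof. by case: k u => [|[|k]]. Qed.

Lemma ltn_Zp k (u : 'Z_k) : 1 < k -> u < k.
Proof. by case: k u => [|[|k]] // u _; apply: ltn_ord. Qed.

Lemma val_Zp_eq0 k (u : 'Z_k) : (u == 0%R) = (val u == 0).
Proof. by []. Qed.

(** The value k/2 given to 0 is exactly what makes the residue 0 = -0 obey the same rule as the
    others. *)
Lemma pweight1_opp k (u : 'Z_k) :
  1 < k -> (pweight1 (- u) = k%:R - pweight1 u :> rat)%R.
Proof.
move=> k1; rewrite /pweight1 oppr_eq0; case: ifP => [_|]; first by lra.
rewrite val_Zp_eq0 => /negbT; rewrite -lt0n => u0; rewrite val_Zopp //.
have ltu := ltn_Zp u k1.
by rewrite modn_small ?natrB ?(ltnW ltu) // ltn_subrL u0 ltnW.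
Qed.

Lemma pweight1_1 k : 1 < k -> (pweight1 (1 : 'Z_k) = 1)%R.
Proof. by case: k => [|[|k]]. Qed.

(** Nonzero residues other than 1 weigh at least 2, and 0 weighs k/2, which exceeds 1 as soon as k
    is at least 3. *)
Lemma pweight1_gt1 k (u : 'Z_k) : 2 < k -> (u != 1 -> 1 < pweight1 u)%R.
Proof.
move=> k2 u1; rewrite /pweight1; case: ifP => [_|].
  have : (3%:R <= k%:R :> rat)%R by rewrite ler_nat.
  by move=> *; lra.
rewrite val_Zp_eq0 => u0; rewrite (ltr_nat rat 1%N).
have : val u != 1 by case: k k2 u u1 {u0} => [|[|k]].
by rewrite -[nat_of_ord u]/(val u); case: (val u) u0 => [|[|m]].
Qed.

Lemma pweight_seq k n (t : n.-tuple 'Z_k) :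
  (pweight t = \sum_(u <- t) pweight1 u)%R.
Proof. by rewrite big_tuple. Qed.

Lemma pweight_negt k n (t : n.-tuple 'Z_k) :
  1 < k -> (pweight (negt t) = (n * k)%N%:R - pweight t)%R.
Proof.
move=> k1; rewrite /pweight natrM mulr_natl.
rewrite -[X in (_ *+ X)%R](card_ord n) -sumr_const -sumrB.
by apply: eq_bigr => i _; rewrite tnth_map pweight1_opp.
Qed.

Lemma pweight_perm k n (t u : n.-tuple 'Z_k) : perm_eq t u -> pweight t = pweight u.
Proof. by move=> ptu; rewrite !pweight_seq; apply: perm_big. Qed.

Lemma negtK k n : involutive (@negt k n).
Proof.
move=> t; apply: eq_from_tnth => i; rewrite !tnth_map; exact: opprK.
Qed.

(** * Rotation circuits and the choice of one from each pair *)

Lemma rot_iter (T : Type) i (s : seq T) : i <= size s -> rot i s = iter i (rot 1) s.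
Proof.
by elim: i => [|i IHi] les; rewrite ?rot0 // rotS // IHi // ltnW.
Qed.

Lemma iter_rot_size (T : Type) q (s : seq T) : iter (q * size s) (rot 1) s = s.
Proof.
elim: q => // q IHq; rewrite mulSn iterD IHq -rot_iter // rot_size //.
Qed.

Lemma iter_rot_tuple (T : Type) n q (t : n.-tuple T) : iter (q * n) (rot 1) t = t.
Proof. by rewrite -[X in _ * X](size_tuple t) iter_rot_size. Qed.

Lemma circuitP k n (a t : n.-tuple 'Z_k) : 0 < n ->
  reflect (exists i, val t = iter i (rot 1) a) (t \in circuit a).
Proof.
move=> n0; apply: (iffP imsetP) => [[i _ ->]|[i ti]].
  by exists i; rewrite /= rot_iter // size_tuple ltnW.
exists (Ordinal (ltn_pmod i n0)) => //; apply: val_inj; rewrite ti.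
rewrite [in LHS](divn_eq i n) addnC iterD.
by rewrite iter_rot_tuple [RHS]rot_iter // size_tuple ltnW // ltn_pmod.
Qed.

Lemma circuit_id k n (a : n.-tuple 'Z_k) : 0 < n -> a \in circuit a.
Proof. by move=> n0; apply/circuitP => //; exists 0. Qed.

Lemma circuit_rot k n (a t : n.-tuple 'Z_k) : 0 < n ->
  t \in circuit a -> [tuple of rot 1 t] \in circuit a.
Proof.
move=> n0 /circuitP [] // i ti; apply/circuitP => //.
by exists i.+1; rewrite /= ti.
Qed.

Lemma eq_circuit k n (a t : n.-tuple 'Z_k) : 0 < n ->
  t \in circuit a -> circuit t = circuit a.
Proof.
move=> n0 /circuitP [] // i ti; apply/setP => u.
apply/circuitP/circuitP => // -[j uj].
  by exists (j + i); rewrite iterD -ti.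
(* Rotating [i * n.-1] further places undoes the [i] rotations from [a] to [t], the total being a
   multiple of [n]. *)
exists (j + (i * n.-1)); rewrite ti -iterD -addnA [i * _ + i]addnC -mulnS prednK //.
by rewrite iterD iter_rot_tuple.
Qed.

Lemma pweight_circuit k n (a t : n.-tuple 'Z_k) :
  t \in circuit a -> pweight t = pweight a.
Proof. by case/imsetP => i _ ->; apply: pweight_perm; rewrite perm_rot. Qed.

Lemma iter_rot_negt k n (a : n.-tuple 'Z_k) i :
  val (negt a) = iter i (rot 1) a ->
  forall m, val (iter m (@negt k n) a) = iter (m * i) (rot 1) a.
Proof.
move=> ai; elim=> // m IHm; rewrite mulSn iterD -IHm /=.
have map_iter (s : seq 'Z_k) j :
    map -%R%R (iter j (rot 1) s) = iter j (rot 1) (map -%R%R s).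
  by elim: j => //= j <-; rewrite map_rot.
have comm j : map -%R%R (val (iter j (@negt k n) a)) =
  iter i (rot 1) (iter j (@negt k n) a).
  elim: j => [|j IHj]; first exact: ai.
  by rewrite iterS /= -map_iter -IHj.
exact: comm.
Qed.

Lemma neg_circuitE k n (a : n.-tuple 'Z_k) :
  neg_circuit (circuit a) = circuit (negt a).
Proof.
rewrite /neg_circuit /circuit -imset_comp; apply: eq_imset => i.
by apply: val_inj; rewrite /= map_rot.
Qed.

(** If negation acts on [a] as a rotation, then negating [n] times rotates by a multiple of [n],
    which is the identity; for [n] odd, negating [n] times is negating once. *)
Lemma odd_circuit_negt k n (a : n.-tuple 'Z_k) : odd n ->
  negt a \in circuit a -> negt a = a.
Proof.
move=> n_odd /circuitP []; first by case: n n_odd {a}.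
move=> i ai; have := iter_rot_negt ai n.
rewrite mulnC iter_rot_tuple => /val_inj.
have negt2 j : iter j.*2 (@negt k n) a = a by elim: j => //= j ->; rewrite negtK.
have -> : iter n (@negt k n) a = iter (odd n + n./2.*2) (@negt k n) a.
  by rewrite odd_double_half.
by rewrite n_odd iterD negt2.
Qed.

Lemma circuit_choice_exists k n : 1 < k -> odd n ->
  exists P : {set {set n.-tuple 'Z_k}}, circuit_choice P.
Proof.
move=> k1 n_odd; have n0 : 0 < n by case: n n_odd.
(* From each pair the circuit that comes first in the enumeration is chosen. *)
exists [set C in Cstar k n | enum_rank C < enum_rank (neg_circuit C)].
split; first by apply/subsetP => C; rewrite inE => /andP [].
move=> C CC; case/imsetP: (CC) => a; rewrite inE => /andP [wa na] Ca.
have nC : neg_circuit (neg_circuit C) = C.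
  by rewrite Ca !neg_circuitE negtK.
have neqC : enum_rank (neg_circuit C) != enum_rank C.
  rewrite (inj_eq enum_rank_inj) Ca neg_circuitE; apply: contra na => /eqP eqC.
  apply/forall_inP => t /imsetP [i _ ->].
  have /(odd_circuit_negt n_odd) aE : negt a \in circuit a by rewrite -eqC circuit_id.
  by apply/eqP/val_inj; rewrite /= map_rot -{1}aE.
have nCC : neg_circuit C \in Cstar k n.
  rewrite Ca neg_circuitE; apply/imsetP; exists (negt a) => //; rewrite inE.
  rewrite pweight_negt // (eqP wa) (mulnC n); apply/andP; split; first by apply/eqP; lra.
  apply: contra na => /forall_inP nself; apply/forall_inP => t ta.
  have := nself (negt t); rewrite -neg_circuitE imset_f // => /(_ isT).
  by rewrite /self_negative negtK eq_sym.
rewrite !inE CC nCC nC /=; move: neqC; rewrite -(inj_eq val_inj) /=.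
by case: ltngtP.
Qed.

(** * The set F_k(n) under rotation and negation *)

Section Antipodal.
Variables (k n : nat) (P : {set {set n.-tuple 'Z_k}}).
Hypotheses (k2 : 2 < k) (n0 : 0 < n) (choiceP : circuit_choice P).

Lemma cover_choiceP t :
  reflect [/\ pweight t = ((k * n)%N%:R / 2)%R, negt t != t & circuit t \in P]
          (t \in cover P).
Proof.
case: choiceP => /subsetP PC _.
apply: (iffP bigcupP) => [[C CP tC]|[wt nt tP]]; last first.
  by exists (circuit t); rewrite ?circuit_id.
case/imsetP: (PC _ CP) => a; rewrite inE => /andP [/eqP wa na] Ca.
rewrite Ca in tC CP na *; rewrite (eq_circuit n0 tC) (pweight_circuit tC) //.
split=> //; apply: contra na => /eqP tt; rewrite -(eq_circuit n0 tC).
apply/forall_inP => _ /imsetP [i _ ->].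
by apply/eqP/val_inj; rewrite /= map_rot -{1}tt.
Qed.

Lemma Fset_rot t : t \in Fset P -> [tuple of rot 1 t] \in Fset P.
Proof.
rewrite !inE; have tc := circuit_rot n0 (circuit_id t n0).
rewrite (pweight_circuit tc); case/orP => [->//|].
case/bigcupP => C CP tC; apply/orP; right; apply/bigcupP; exists C => //.
have [a _ Ca] := imsetP (subsetP (proj1 choiceP) _ CP).
by move: tC; rewrite Ca; apply: circuit_rot.
Qed.

Lemma Fset_pweight t : t \in Fset P -> (pweight t <= (n * k)%N%:R / 2)%R.
Proof.
rewrite inE inE => /orP [/ltW //|/cover_choiceP [-> _ _]]; by rewrite mulnC.
Qed.

Lemma self_negative_pweight (t : n.-tuple 'Z_k) :
  negt t = t -> (pweight t = (n * k)%N%:R / 2 :> rat)%R.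
Proof. move=> /(congr1 (@pweight k n)); rewrite pweight_negt; [lra | exact: ltnW]. Qed.

Lemma Fset_negt (t : n.-tuple 'Z_k) : t \in Fset P -> negt t != t.
Proof.
rewrite inE inE => /orP [wt|/cover_choiceP [] //].
by apply: contraTneq wt => /self_negative_pweight ->; rewrite ltxx.
Qed.

(** Negation reflects pseudoweights in nk/2. Off that level [Eset] contains exactly one of the two
    tuples; on it, the choice of circuits decides. *)
Lemma Fset_antipodal (t : n.-tuple 'Z_k) : negt t != t -> (t \in Fset P) (+) (negt t \in Fset P).
Proof.
move=> nt; have wn := pweight_negt t (ltnW k2).
rewrite !inE; case: (ltrgtP (pweight t) ((n * k)%N%:R / 2)%R) => wt /=.
- apply/negP => /orP [|/cover_choiceP []]; rewrite wn ?(mulnC k); lra.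
- have -> /= : t \in cover P = false.
    apply/negP => /cover_choiceP []; rewrite ?(mulnC k); lra.
  apply/orP; left; rewrite wn; lra.
have -> /= : (pweight (negt t) < (n * k)%:R / 2 = false)%R.
  by apply/negP; rewrite wn; lra.
have cC : circuit t \in Cstar k n.
  apply/imsetP; exists t => //; rewrite inE mulnC wt eqxx /=.
  apply: contra nt => /forall_inP /(_ _ (circuit_id t n0)) /eqP {2}->; exact/eqP.
have cov u : pweight u = ((n * k)%:R / 2)%R -> negt u != u ->
    u \in cover P = (circuit u \in P).
  move=> wu nu; apply/cover_choiceP/idP => [[]//|uP].
  by split; rewrite // wu mulnC.
rewrite !cov //; last 2 first.
- by rewrite wn wt; lra.
- by rewrite negtK eq_sym.
by rewrite -neg_circuitE; apply: (proj2 choiceP).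
Qed.

End Antipodal.

(** * The Lempel homomorphism *)

Lemma nth_Lempel k n (e : n.+1.-tuple 'Z_k) i :
  i < n -> ((Lempel e)`_i = e`_i.+1 - e`_i)%R.
Proof. by move=> ltin; rewrite /Lempel nth_tuple_of. Qed.

Lemma nth_negt k n (t : n.-tuple 'Z_k) i : ((negt t)`_i = - t`_i)%R.
Proof.
have [ltin|lein] := ltnP i n; first by rewrite (nth_map 0%R) ?size_tuple.
by rewrite !nth_default ?oppr0 ?size_tuple.
Qed.

Lemma Lempel_negt k n (e : n.+1.-tuple 'Z_k) : Lempel (negt e) = negt (Lempel e).
Proof.
apply: eq_from_nth0 => i lti.
by rewrite nth_negt !nth_Lempel // !nth_negt opprB addrC opprK.
Qed.

Lemma Lempel_inj k n (e e' : n.+1.-tuple 'Z_k) :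
  Lempel e = Lempel e' -> (e`_0 = e'`_0)%R -> e = e'.
Proof.
move=> eqD eq0; apply: eq_from_nth0; elim=> // i IHi lti.
have := congr1 (fun t : n.+1.-1.-tuple 'Z_k => t`_i)%R eqD; rewrite !nth_Lempel //.
by rewrite IHi; [move/addIr | exact: ltnW].
Qed.

(** The circuits b_x are translates of one another; hence they all lie over the same n-tuples. *)
Lemma Lempel_shift k n (s : nat -> 'Z_k) x i :
  Lempel (window (fun m => x + s m)%R n.+1 i) = Lempel (window s n.+1 i).
Proof.
apply: eq_from_nth0 => j ltj; have ltj' : j < n.+1 by apply: ltnW.
rewrite !nth_Lempel // !nth_window //.
by rewrite opprD addrACA subrr add0r.
Qed.

Lemma nth_rot1 (T : Type) x0 (s : seq T) i : i < size s ->
  nth x0 (rot 1 s) i = if i.+1 < size s then nth x0 s i.+1 else nth x0 s 0.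
Proof.
case: s => // x s; rewrite rot1_cons nth_rcons /= !ltnS => lti.
by case: ltnP => // lesi; rewrite eqn_leq lti lesi.
Qed.

Lemma balanced_Lempel_preim k n (F : {set n.-tuple 'Z_k}) : 0 < n ->
  (forall t, t \in F -> [tuple of rot 1 t] \in F) ->
  balanced [set e : n.+1.-tuple 'Z_k | Lempel e \in F].
Proof.
move=> n0 F_rot.
(* The appended entry makes the new last difference equal to the discarded first one, so the Lempel
   image is rotated. *)
pose g (e : n.+1.-tuple 'Z_k) : n.+1.-tuple 'Z_k :=
  [tuple (if (i < n)%N then e`_i.+1 else e`_n + (e`_1 - e`_0))%R | i < n.+1].
have nth_g e i : i < n.+1 ->
    ((g e)`_i = if (i < n)%N then e`_i.+1 else e`_n + (e`_1 - e`_0))%R.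
  by move=> lti; rewrite /g nth_tuple_of.
apply: (@balanced_of_succ _ _ _ g) => [e e' _ _ eq_g | e].
  have nth_eq i : i < n.+1 -> ((g e)`_i = (g e')`_i)%R by rewrite eq_g.
  have succ_eq i : i < n -> (e`_i.+1 = e'`_i.+1)%R.
    move=> lti; have lti' : i < n.+1 by apply: ltnW.
    by have := nth_eq i lti'; rewrite !nth_g ?lti.
  apply: eq_from_nth0 => -[_|i]; last exact: succ_eq.
  (* Only the first entry remains to be recovered: the last entries of [g e] and [g e'] agree, and
     so do entries 1 and [n] of [e] and [e']. *)
  have := nth_eq n (ltnSn n); rewrite !nth_g // ltnn (succ_eq 0) //.
  have <- : (e`_n = e'`_n)%R by have := succ_eq n.-1; rewrite prednK //; apply.
  by move=> /addrI /addrI /oppr_inj.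
rewrite !inE => eF; split; last first.
  apply: eq_from_nth0 => i lti; have lti' : i < n.+1 by apply: ltnW.
  by rewrite nth_src // nth_tgt // nth_g // lti.
have -> : Lempel (g e) = [tuple of rot 1 (Lempel e)]; last exact: F_rot.
apply: eq_from_nth0 => i lti; have lti' : i < n.+1 by apply: ltnW.
rewrite nth_Lempel // !nth_g // (lti : i < n).
have szD : size (Lempel e) = n by rewrite size_tuple.
rewrite /= nth_rot1 szD ?(lti : i < n) //; case: ifP => ltSi; first by rewrite nth_Lempel.
have -> : i.+1 = n by apply/eqP; rewrite eqn_leq lti leqNgt ltSi.
by rewrite nth_Lempel // addrC addKr.
Qed.

Lemma oppr1_Zp_neq1 k : 2 < k -> (- 1 != 1 :> 'Z_k)%R.
Proof.
case: k => [|[|[|k]]] // _; apply/eqP => /(congr1 (@nat_of_ord _)).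
by rewrite /= modn_small.
Qed.

(* The common shape of the circuits b_x: b_x consists of the windows of x + beta.
   For odd k, beta is constantly 0 and M = 1. *)
Definition tail_sequence k n M (beta : nat -> 'Z_k) : Prop :=
  [/\ 0 < M, forall i, beta (i + M) = beta i, forall i, (- beta i)%R = beta i,
      forall i j, i < M -> j < M ->
        Lempel (window beta n.+1 i) = Lempel (window beta n.+1 j) -> i = j
    & forall t : n.-tuple 'Z_k, negt t = t ->
        exists i, Lempel (window beta n.+1 i) = t].

(** Indexing by pairs of a translation and a position presents the union of circuits as the image of
    one map, to which [balanced_image] applies. *)
Definition tail_edges k n (M : nat) (beta : nat -> 'Z_k) : {set n.+1.-tuple 'Z_k} :=
  [set window (fun m => (p.1 : nat)%:R + beta m)%R n.+1 p.2
    | p : 'I_k * 'I_M in [set p : 'I_k * 'I_M | (0 < p.1) && (p.1.*2 < k)]].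

(** * The edge set of Z_k(n): balance, connectedness, negation, size *)

Section Zset.
Variables (k n M : nat) (beta : nat -> 'Z_k) (P : {set {set n.-tuple 'Z_k}}).
Hypotheses (k2 : 2 < k) (n0 : 0 < n) (choiceP : circuit_choice P).
Hypothesis tailb : tail_sequence n M beta.

Local Notation Z :=
  ([set e : n.+1.-tuple 'Z_k | Lempel e \in Fset P] :|: tail_edges n M beta).

Lemma window_mod x i :
  window (fun m => x + beta m)%R n.+1 (i %% M) = window (fun m => x + beta m)%R n.+1 i.
Proof.
case: tailb => M0 per _ _ _; apply: eq_from_nth0 => j ltj; rewrite !nth_window //.
rewrite [in RHS](divn_eq i M) -addnA [in RHS]addnC; congr (_ + _)%R.
elim: (i %/ M) => [|q ->]; first by rewrite addn0.
by rewrite mulSn [M + _]addnC addnA per.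
Qed.

Lemma tail_edgesP e :
  reflect (exists x i, [/\ 0 < x, x.*2 < k &
             e = window (fun m => x%:R + beta m)%R n.+1 i])
          (e \in tail_edges n M beta).
Proof.
apply: (iffP imsetP) => [[[x i]]|[x [i [x0 xk ->]]]].
  by rewrite inE /= => /andP [x0 xk] ->; exists x, i.
have ltxk : x < k by apply: leq_ltn_trans xk; rewrite -addnn leq_addr.
have M0 : 0 < M by case: tailb.
exists (Ordinal ltxk, Ordinal (ltn_pmod i M0)); rewrite ?inE /= ?x0 //.
by rewrite window_mod.
Qed.

(** Taking differences removes the translation, and [beta] is its own negative. This separates the
    tail edges from the preimage of F_k(n), which has no edge over a self-negative tuple. *)
Lemma tail_Lempel_negt e : e \in tail_edges n M beta -> negt (Lempel e) = Lempel e.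
Proof.
case/tail_edgesP => x [i [_ _ ->]]; rewrite Lempel_shift -Lempel_negt; congr Lempel.
case: tailb => _ _ nb _ _.
by apply: eq_from_nth0 => j ltj; rewrite nth_negt nth_window // nb.
Qed.

Lemma Zp_nat_inj x y : x < k -> y < k -> (x%:R = y%:R :> 'Z_k)%R -> x = y.
Proof.
move=> xk yk /(congr1 (@nat_of_ord _)).
by rewrite !val_Zp_nat ?(ltnW k2) // !modn_small.
Qed.

Lemma balanced_tail : balanced (tail_edges n M beta).
Proof.
have [M0 per nb Dinj _] := tailb.
apply: (@balanced_image _ _ _ _ _ (fun p => (p.1, ordS p.2))).
(* The Lempel image determines the position, and then the first entry determines the translation. *)
- move=> [x i] [y j]; rewrite !inE /= => /andP [_ xk] /andP [_ yk] eqw.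
  have := congr1 (@Lempel k n.+1) eqw; rewrite !Lempel_shift.
  move/(Dinj _ _ (ltn_ord i) (ltn_ord j))/val_inj => eij; rewrite -{}eij in eqw *.
  have := congr1 (fun t : n.+1.-tuple 'Z_k => t`_0)%R eqw; rewrite !nth_window //.
  by move=> /addIr /(Zp_nat_inj (ltn_ord x) (ltn_ord y)) /val_inj ->.
- move=> [x i] [y j] _ _ /eqP; rewrite xpair_eqE => /andP [/eqP /= -> /eqP].
  by move/ordS_inj => ->.
move=> [x i]; rewrite !inE /= => ->; split=> //.
rewrite window_mod; apply: eq_from_nth0 => j ltj.
by rewrite nth_src // nth_tgt // !nth_window ?addSnnS // ltnW.
Qed.

Lemma Lempel_Fset_negt (e : n.+1.-tuple 'Z_k) :
  Lempel e \in Fset P -> negt (Lempel e) != Lempel e.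
Proof. exact: Fset_negt. Qed.

Lemma balanced_Z : balanced Z.
Proof.
apply: balanced_setU balanced_tail; last first.
  by apply: balanced_Lempel_preim => // t; apply: Fset_rot.
apply/pred0P => e; apply/negP => /andP [+ /= /tail_Lempel_negt eD].
by rewrite inE in_set => /Lempel_Fset_negt; rewrite eD eqxx.
Qed.

Lemma Z_pweight e : e \in Z -> (pweight (Lempel e : n.-tuple _) <= (n * k)%N%:R / 2)%R.
Proof.
rewrite inE => /orP [|/tail_Lempel_negt eD]; first by rewrite inE; apply: Fset_pweight.
by rewrite (self_negative_pweight k2 eD).
Qed.

(* Replacing the first entry of a tuple by a final 1 lowers its pseudoweight,
   unless that entry is 1, in which case the tuple is just rotated. *)
Lemma Z_step (s : nat -> 'Z_k) i :
  window s n.+1 i \in Z -> (s (i + n.+1)%N = s (i + n)%N + 1)%R ->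
  window s n.+1 i.+1 \in Z.
Proof.
move=> sZ last1.
set d : n.-tuple 'Z_k := Lempel (window s n.+1 i).
set d' : n.-tuple 'Z_k := Lempel (window s n.+1 i.+1).
have d'E : val d' = rcons (behead d) 1%R.
  apply: (@eq_from_nth _ 0%R); first by rewrite size_rcons size_behead !size_tuple prednK.
  move=> j; rewrite size_tuple => ltj; rewrite nth_rcons size_behead !size_tuple nth_behead.
  have ltj' : j < n.+1 by apply: ltnW.
  rewrite nth_Lempel // !nth_window // !addSnnS.
  case: ltngtP => [ltjn|ltjn|->].
  - have ltSj : j.+1 < n by rewrite -ltn_predRL.
    have ltSj' : j.+1 < n.+1 by apply: ltnW.
    by rewrite nth_Lempel // !nth_window.
  - by rewrite -ltnS prednK // ltnNge ltj in ltjn.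
  by rewrite prednK // last1 addrC addKr.
have dE : val d = (d`_0)%R :: behead d by case: d {d'E} => [[|]] //=; case: n n0.
have pd : pweight d = (pweight1 (d`_0) + \sum_(u <- behead d) pweight1 u)%R.
  by rewrite pweight_seq dE big_cons.
have pd' : pweight d' = (1 + \sum_(u <- behead d) pweight1 u)%R.
  by rewrite pweight_seq d'E -cats1 big_cat big_seq1 /= pweight1_1 ?(ltnW k2) // addrC.
have pZ := Z_pweight sZ; rewrite -/d in pZ.
have [d1|d1] := eqVneq (d`_0)%R 1%R; last first.
  have := pweight1_gt1 k2 d1 => gt1.
  by rewrite !inE -/d' pd' (_ : _ < _)%R //; lra.
have d'rot : d' = [tuple of rot 1 d].
  by apply: val_inj; rewrite d'E -[RHS]/(rot 1 (val d)) [in RHS]dE rot1_cons d1.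
case/setUP: sZ => [|/tail_Lempel_negt].
  rewrite in_set -/d => /(Fset_rot n0 choiceP) dF.
  by apply/setUP; left; rewrite in_set -/d' d'rot.
(* A tail edge has a self-negative image, whose first entry cannot be 1 because -1 differs from
   1. *)
rewrite -/d => /(congr1 (fun t : n.-tuple 'Z_k => t`_0)%R); rewrite nth_negt d1.
by move/eqP; rewrite (negPf (oppr1_Zp_neq1 k2)).
Qed.

Lemma connected_Z : connected (edge_graph Z).
Proof.
apply: (@connected_of_walks _ _ _ (window (fun m => m%:R)%R n.+1 0)) => e eZ.
(* The walk spells [e] and continues from its last entry in steps of 1. *)
pose s m := (if (m < n.+1)%N then e`_m else e`_n + (m - n)%N%:R)%R.
have s_tail m : (s (n + m)%N = e`_n + m%:R)%R.
  rewrite /s addKn -[X in _ < X]addn1 ltn_add2l.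
  by case: m => [|m] //=; rewrite addn0 addr0.
(* At this index the progression reaches [e_n + (- e_n) = 0], so the window there is the hub 0, 1,
   2, and so on. *)
exists s, (n + nat_of_ord (- e`_n)%R); split.
- by apply: eq_from_nth0 => j ltj; rewrite nth_window // /s ltj.
- apply: eq_from_nth0 => j ltj; rewrite !nth_window // -addnA s_tail.
  by rewrite natrD natr_Zp addrA addrN !add0r.
elim=> [|i IHi].
  rewrite (_ : window _ _ _ = e) //.
  by apply: eq_from_nth0 => j ltj; rewrite nth_window // /s ltj.
by apply: Z_step => //; rewrite addnS -addSn !(addnC _ n) !s_tail -natr1 addrA.
Qed.

Lemma eulerian_Z : eulerian (edge_graph Z).
Proof. exact: balanced_eulerian balanced_Z connected_Z. Qed.

Lemma window_negt x i :
  negt (window (fun m => x + beta m)%R n.+1 i) = window (fun m => - x + beta m)%R n.+1 i.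
Proof.
case: tailb => _ _ nb _ _.
by apply: eq_from_nth0 => j ltj; rewrite nth_negt !nth_window // opprD nb.
Qed.

Lemma Z_negt e : e \in Z -> negt e \notin Z.
Proof.
have [M0 per nb Dinj _] := tailb.
have tailN u : u \in tail_edges n M beta -> negt u \in Z -> negt u \in tail_edges n M beta.
  move=> /tail_Lempel_negt uD; rewrite in_setU => /orP [|//].
  by rewrite in_set => /Lempel_Fset_negt; rewrite Lempel_negt !uD eqxx.
move=> eZ; apply/negP => neZ; move: (eZ); rewrite in_setU => /orP [eF|eT].
  move: (neZ); rewrite in_setU => /orP [neF|neT]; last first.
    have := tailN _ neT; rewrite negtK => /(_ eZ) /tail_Lempel_negt eD.
    by move: eF; rewrite in_set => /Lempel_Fset_negt; rewrite eD eqxx.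
  move: eF neF; rewrite in_set => eF; rewrite in_set Lempel_negt => neF.
  have := Fset_antipodal k2 n0 choiceP (Lempel_Fset_negt eF).
  by rewrite neF eF.
case/tail_edgesP: (tailN _ eT neZ) => y [j [y0 yk]].
case/tail_edgesP: eT => x [i [x0 xk ->]].
rewrite window_negt -[LHS]window_mod -[RHS]window_mod => eqw.
have := congr1 (@Lempel k n.+1) eqw; rewrite !Lempel_shift.
move/(Dinj _ _ (ltn_pmod _ M0) (ltn_pmod _ M0)) => eij; rewrite {}eij in eqw.
have := congr1 (fun t : n.+1.-tuple 'Z_k => t`_0)%R eqw; rewrite !nth_window //.
(* Equal positions leave [y + x = 0] modulo [k], impossible for positive [x] and [y] below k/2. *)
move=> /addIr /eqP; rewrite eq_sym -addr_eq0 -natrD => /eqP.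
move/(@Zp_nat_inj _ 0) => xy; have : y + x = 0 by apply: xy; lia.
lia.
Qed.

Lemma Z_complete e : negt e != e -> (e \in Z) || (negt e \in Z).
Proof.
have [M0 per nb Dinj Dsurj] := tailb.
move=> ne; have [eD|nD] := eqVneq (negt (Lempel e : n.-tuple 'Z_k)) (Lempel e); last first.
  have := Fset_antipodal k2 n0 choiceP nD; case: (boolP (Lempel e \in _)) => eF /= neF.
    by apply/orP; left; apply/setUP; left; rewrite in_set.
  by apply/orP; right; apply/setUP; left; rewrite in_set Lempel_negt.
have [i iD] := Dsurj _ eD.
(* Over a self-negative tuple, [e] is the translate of a window of [beta] by this [x]. Since [e] is
   not self-negative, [x] is neither 0 nor k/2, so [x] or [-x] lies strictly between them. *)
pose x := (e`_0 - beta i)%R.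
have eE : e = window (fun m => x + beta m)%R n.+1 i.
  apply: Lempel_inj; first by rewrite Lempel_shift iD.
  by rewrite nth_window // addn0 subrK.
have ltx := ltn_Zp x (ltnW k2).
have valN : nat_of_ord (- x)%R = (k - x) %% k := val_Zopp x (ltnW k2).
have x0 : 0 < x.
  rewrite lt0n; apply: contraNneq ne => x0; rewrite eE window_negt.
  by have -> : x = 0%R; [apply: val_inj | rewrite oppr0].
rewrite modn_small in valN; last by rewrite ltn_subrL x0 ltnW // ltnW.
have xk : x.*2 != k.
  apply: contraNneq ne => xk; rewrite eE window_negt.
  suff -> : (- x)%R = x by [].
  by apply: ord_inj; rewrite valN; lia.
apply/orP; move: xk; rewrite neq_ltn => /orP [xk|xk]; [left|right]; rewrite in_setU.
  by apply/orP; right; apply/tail_edgesP; exists x, i; rewrite natr_Zp.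
apply/orP; right; apply/tail_edgesP; exists (nat_of_ord (- x)%R), i.
by rewrite natr_Zp valN {1}eE window_negt; split=> //; lia.
Qed.

(** By [Z_negt] and [Z_complete], the set Z, its negative and the self-negative tuples partition all
    tuples. *)
Lemma card_Z : #|Z|.*2 + #|[set e : n.+1.-tuple 'Z_k | negt e == e]| = k ^ n.+1.
Proof.
have -> : k ^ n.+1 = #|{: n.+1.-tuple 'Z_k}|.
  by rewrite card_tuple card_ord; case: (k) k2 => [|[|]].
have negt_inj : injective (@negt k n.+1) := inv_inj (@negtK k n.+1).
rewrite -(cardsC Z) -addnn -addnA; congr (_ + _).
rewrite -(card_imset _ negt_inj) -cardsUI.
have -> : (@negt k n.+1 @: Z) :&: [set e | negt e == e] = set0.
  apply/setP => e; rewrite !inE; apply/negP => /andP [/imsetP [u uZ ->]].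
  by rewrite negtK => /eqP uu; have := Z_negt uZ; rewrite -uu uZ.
rewrite cards0 addn0; apply: eq_card => e; rewrite in_setC in_setU.
rewrite -{1}(negtK e) (mem_imset _ _ negt_inj) inE.
have [ee|ne] := eqVneq (negt e) e.
  by rewrite orbT; apply/esym/negP => eZ; have := Z_negt eZ; rewrite ee eZ.
rewrite orbF; apply/idP/negP => [neZ eZ|eZ].
  by have := Z_negt eZ; rewrite neZ.
by have := Z_complete ne; case/orP.
Qed.

End Zset.

(** * Counting self-negative tuples *)

Lemma card_tuple_all (T : finType) (H : {set T}) r :
  #|[set t : r.-tuple T | all (mem H) t]| = #|H| ^ r.
Proof.
pose sT := {x | x \in H}.
have -> : #|H| = #|{: sT}| by rewrite card_sig; apply: eq_card.
rewrite -card_tuple -cardsT -(@card_imset _ _ (fun t : r.-tuple sT => [tuple of map val t])).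
  apply: eq_card => t; rewrite inE; apply/idP/imsetP => [/allP tH|[u _ ->]]; last first.
    by rewrite all_map; apply/allP => x _; apply: (valP x).
  have tHi i : tnth t i \in H by apply: tH; apply: mem_tnth.
  exists [tuple (Sub (tnth t i) (tHi i) : sT) | i < r]; rewrite ?inE //.
  by apply: eq_from_tnth => i; rewrite tnth_map tnth_mktuple.
move=> t u /(congr1 val) /= eqtu; apply: val_inj; exact: inj_map val_inj _ _ eqtu.
Qed.

Lemma Zp_opp_eq k (u : 'Z_k) : 1 < k ->
  (- u == u)%R = (u == 0%R) || ~~ odd k && (u == (k %/ 2)%:R%R).
Proof.
move=> k1; have ltu := ltn_Zp u k1.
have vE (x y : 'Z_k) : (x == y) = (nat_of_ord x == nat_of_ord y) by [].
have vN : nat_of_ord (- u)%R = (k - u) %% k := val_Zopp u k1.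
rewrite 3!vE vN val_Zp_nat // (@modn_small (k %/ 2)) ?ltn_Pdiv ?(ltnW k1) //.
have v0 : nat_of_ord (0%R : 'Z_k) = 0 by [].
rewrite v0 divn2; have := odd_double_half k; set v := nat_of_ord u in ltu *.
have [->|v0'] := posnP v; first by rewrite subn0 modnn eqxx.
rewrite modn_small; last by rewrite ltn_subrL v0' ltnW.
by case: (odd k) => /=; lia.
Qed.

Lemma negt_all k r (t : r.-tuple 'Z_k) :
  (negt t == t) = all (mem [set u : 'Z_k | - u == u]%R) t.
Proof.
rewrite -val_eqE /=; elim: (val t) => //= u s IHs.
by rewrite eqseq_cons IHs inE.
Qed.

Lemma card_Zp_opp_eq k : 1 < k ->
  #|[set u : 'Z_k | - u == u]%R| = if odd k then 1 else 2.
Proof.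
move=> k1; have eqH u := Zp_opp_eq u k1.
case: ifP eqH => [_|/negbT k_even] eqH.
  rewrite -(cards1 (0%R : 'Z_k)); apply: eq_card => u.
  by rewrite !inE eqH orbF.
have -> : [set u : 'Z_k | - u == u]%R = [set 0%R; (k %/ 2)%:R%R].
  by apply/setP => u; rewrite !inE eqH.
rewrite cards2; suff -> : (0%R : 'Z_k) != (k %/ 2)%:R%R by [].
apply/eqP => /(congr1 (@nat_of_ord _)); rewrite val_Zp_nat // modn_small ?ltn_Pdiv ?(ltnW k1) //.
rewrite divn2 => /esym k0; have := odd_double_half k.
by rewrite (negPf k_even) -[X in X = _]/(k./2.*2) [k./2]k0 => k0'; rewrite -k0' in k1.
Qed.

Lemma card_self_negative k r : 1 < k ->
  #|[set t : r.-tuple 'Z_k | negt t == t]| = if odd k then 1 else 2 ^ r.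
Proof.
move=> k1; transitivity (#|[set u : 'Z_k | - u == u]%R| ^ r).
  by rewrite -card_tuple_all; apply: eq_card => t; rewrite !inE negt_all.
by rewrite card_Zp_opp_eq //; case: ifP; rewrite ?exp1n.
Qed.

Lemma in_0halfE k (u : 'Z_k) : 1 < k -> ~~ odd k -> in_0half u = (- u == u)%R.
Proof. by move=> k1 k_even; rewrite Zp_opp_eq // k_even. Qed.

Lemma all_in_0half k r (t : r.-tuple 'Z_k) : 1 < k -> ~~ odd k ->
  all (@in_0half k) t = (negt t == t).
Proof.
move=> k1 k_even; rewrite negt_all; apply: eq_all => u.
by rewrite in_0halfE //= inE.
Qed.

(** * Circuits over {0, k/2} and their partial sums *)

(** The graph is balanced because rotation is a successor map on its edges, and connected because
    appending zeros leads every edge to the zero tuple. *)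
Lemma T_circuit_exists k n : 1 < k -> ~~ odd k -> 0 < n ->
  exists a : (2 ^ n).-tuple 'Z_k, T_circuit a.
Proof.
move=> k1 k_even; case: n => // n _.
pose E := [set t : n.+1.-tuple 'Z_k | all (@in_0half k) t].
have cardE : #|E| = 2 ^ n.+1.
  transitivity (if odd k then 1 else 2 ^ n.+1); last by rewrite (negPf k_even).
  rewrite -card_self_negative //; apply: eq_card => t.
  by rewrite !inE all_in_0half.
have half0 : in_0half (0%R : 'Z_k) by rewrite /in_0half eqxx.
have window_half (s : nat -> 'Z_k) i :
    (forall m, in_0half (s m)) -> window s n.+1 i \in E.
  move=> sH; rewrite inE; apply/allP => x /tnthP [j ->].
  by rewrite tnth_mktuple.
have half_window s i j : window s n.+1 i \in E -> j < n.+1 -> in_0half (s (i + j)).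
  rewrite inE => /allP sE ltj; rewrite -(nth_window s i ltj).
  by apply: sE; rewrite mem_nth // size_tuple.
have balE : balanced E.
  apply: (@balanced_of_succ _ _ _ (fun t => [tuple of rot 1 t])).
    by move=> t u _ _ /(congr1 val) /= /rot_inj eqtu; apply: val_inj.
  move=> t; rewrite inE => tH; split.
    by rewrite inE (perm_all _ (s2 := t)) ?perm_rot.
  apply: eq_from_nth0 => i lti; rewrite nth_src // nth_tgt //=.
  have ltSi : i.+1 < n.+1 by [].
  by rewrite nth_rot1 size_tuple; [rewrite ltSi | apply: ltnW].
have connE : connected (edge_graph E).
  apply: (@connected_of_walks _ _ _ (window (fun=> 0%R) n.+1 0)) => e eE.
  (* The default value 0 of [nth] supplies the appended zeros. *)
  exists (nth 0%R e), n.+1; split.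
  - by apply: eq_from_nth0 => j ltj; rewrite nth_window.
  - apply: eq_from_nth0 => j ltj; rewrite !nth_window // nth_default //.
    by rewrite size_tuple leq_addr.
  move=> i; apply: window_half => m.
  have [ltm|lem] := ltnP m n.+1; last by rewrite nth_default ?size_tuple.
  by move: eE; rewrite inE => /allP; apply; rewrite mem_nth ?size_tuple.
have E0 : E != set0 by rewrite -card_gt0 cardE expn_gt0.
have [s [per sE s_inj]] := eulerian_sequence E0 (balanced_eulerian balE connE).
rewrite cardE in per s_inj.
have s_mod i : s (i %% 2 ^ n.+1) = s i.
  rewrite [in RHS](divn_eq i (2 ^ n.+1)) addnC.
  elim: (i %/ _) => [|q ->]; first by rewrite addn0.
  by rewrite mulSn [2 ^ n.+1 + _]addnC addnA per.
have M0 : 0 < 2 ^ n.+1 by rewrite expn_gt0.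
pose a := [tuple s i | i < 2 ^ n.+1].
have aE i : cwindow a n.+1 i = window s n.+1 i.
  apply: eq_from_nth0 => j ltj; rewrite nth_window // /cwindow nth_tuple_of.
  by rewrite /a nth_tuple_of ?ltn_pmod // => lt; rewrite /= s_mod.
have a_inj : injective (fun i : 'I_(2 ^ n.+1) => cwindow a n.+1 i).
  move=> i j; rewrite !aE => /s_inj; rewrite !modn_small //; exact: val_inj.
exists a; split.
  apply/allP => x /tnthP [j ->]; rewrite tnth_mktuple.
  by rewrite -[nat_of_ord j]addn0; apply: half_window.
(* The windows are distinct, lie in [E] and are as many as its elements. *)
have imE : [set cwindow a n.+1 i | i : 'I_(2 ^ n.+1)] = E.
  apply/eqP; rewrite eqEcard card_imset // cardE card_ord leqnn andbT.
  by apply/subsetP => _ /imsetP [i _ ->]; rewrite aE.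
move=> t tE; have : t \in E by rewrite inE.
rewrite -imE => /imsetP [i _ ->]; exists i; split=> // j /a_inj -> //.
Qed.

(** The terms are the first entries of the windows, that is, of all n-tuples over {0, k/2}. Each
    value is the first entry of 2^(n-1) of them, an even number as n is at least 2, and twice the
    value is 0. *)
Lemma T_circuit_sum k n (a : (2 ^ n).-tuple 'Z_k) : 1 < k -> ~~ odd k -> 1 < n ->
  T_circuit a -> (\sum_(j < 2 ^ n) a`_j = 0)%R.
Proof.
move=> k1 k_even; case: n a => [|[|n]] // a _ [/allP aH aT].
set H := [set u : 'Z_k | - u == u]%R.
have cardH r : #|[set t : r.-tuple 'Z_k | all (mem H) t]| = 2 ^ r.
  by rewrite card_tuple_all card_Zp_opp_eq // (negPf k_even).
pose T := [set t : n.+2.-tuple 'Z_k | all (mem H) t].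
have TE t : (t \in T) = all (@in_0half k) t.
  by rewrite inE all_in_0half // negt_all.
pose w (i : 'I_(2 ^ n.+2)) := cwindow a n.+2 i.
have M0 : 0 < 2 ^ n.+2 by rewrite expn_gt0.
have wT i : w i \in T.
  rewrite TE; apply/allP => x /tnthP [j ->]; rewrite tnth_mktuple; apply: aH.
  by rewrite mem_nth // size_tuple ltn_pmod.
have w_inj : injective w.
  move=> i j wij; have := wT i; rewrite TE => /aT [l [_ uniq_l]].
  by rewrite -(uniq_l i) // -(uniq_l j).
have imT : w @: setT = T.
  apply/eqP; rewrite eqEcard card_imset // cardsT card_ord cardH leqnn andbT.
  by apply/subsetP => _ /imsetP [i _ ->].
transitivity (\sum_(t in T) t`_0)%R.
  rewrite -imT big_imset /=; last by move=> i j _ _; apply: w_inj.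
  apply: eq_big => [i|i _]; first by rewrite inE.
  by rewrite /w /cwindow nth_tuple_of //= addn0 modn_small.
rewrite (partition_big (fun t : n.+2.-tuple 'Z_k => t`_0)%R (mem H)) /=; last first.
  by move=> t; rewrite inE => /allP; apply; rewrite mem_nth ?size_tuple.
apply: big1 => y yH.
transitivity (\sum_(t in [set t in T | t`_0 == y]) y)%R.
  apply: eq_big => [t|t /andP [_ /eqP //]]; by rewrite !inE.
rewrite sumr_const; have -> : #|[set t in T | t`_0 == y]%R| = 2 ^ n.+1.
  rewrite -cardH -(@card_imset _ _ (fun t : n.+1.-tuple 'Z_k => [tuple of y :: t])).
    apply: eq_card => t; rewrite inE; apply/andP/imsetP => [[]|[u + ->]].
      rewrite inE; case/tupleP: t => x u /= /andP [_ uH] /eqP ->.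
      by exists u; rewrite // inE.
    by rewrite !inE /= => ->; rewrite eqxx andbT; move: yH; rewrite inE.
  by move=> t u /(congr1 val) /= [] /val_inj.
rewrite expnS mulrnA mulr2n; move: yH; rewrite inE => /eqP {1}<-.
by rewrite addNr mul0rn.
Qed.

Lemma cwindow_mod k m (b : m.-tuple 'Z_k) r i : cwindow b r (i %% m) = cwindow b r i.
Proof.
by apply: eq_from_nth0 => j ltj; rewrite /cwindow !nth_tuple_of /= modnDml.
Qed.

(** For odd k the only self-negative tuple is zero, so a constant [beta] serves. For even k, [beta]
    is the sequence of partial sums, whose differences run through the Eulerian circuit. *)
Lemma bcircuit_tail_sequence k n (a : (2 ^ n).-tuple 'Z_k) :
  1 < k -> 1 < n -> (~~ odd k -> T_circuit a) ->
  exists M beta, tail_sequence n M beta /\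
    forall x e, e \in bcircuit a x <->
                exists i, e = window (fun m => x + beta m)%R n.+1 i.
Proof.
move=> k1 n1 aT; have [k_odd|k_even] := boolP (odd k).
  exists 1, (fun=> 0%R); split.
    split=> //; [by move=> _; rewrite oppr0 | by case=> [|//] [] |].
    move=> t tt; exists 0.
    apply: eq_from_nth0 => j ltj; rewrite nth_Lempel // !nth_window //; last exact: ltnW.
    rewrite subrr; apply/esym/eqP; have := Zp_opp_eq (t`_j)%R k1.
    by rewrite k_odd orbF => <-; rewrite -nth_negt tt.
  move=> x e; rewrite /bcircuit k_odd inE.
  have wE i : window (fun=> (x + 0)%R) n.+1 i = [tuple x | _ < n.+1].
    by apply: eq_from_nth0 => j ltj; rewrite nth_window // nth_tuple_of // addr0.
  split=> [/eqP ->|[i ->]]; last by apply/eqP; apply: wE.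
  by exists 0; rewrite wE.
have [/allP aH a_uniq] := aT k_even.
have sum0 := T_circuit_sum k1 k_even n1 (aT k_even).
set M := 2 ^ n in a aT aH a_uniq sum0 *.
have M0 : 0 < M by rewrite expn_gt0.
pose beta i := (\sum_(j < (i %% M).+1) a`_j)%R.
have a2 i : (- a`_i = a`_i)%R.
  have [lti|lei] := ltnP i M; last by rewrite nth_default ?oppr0 ?size_tuple.
  by apply/eqP; rewrite -in_0halfE // aH // mem_nth ?size_tuple.
(* At the end of a period the partial sum is the total sum, which is 0, so the next difference is
   still the term of [a]. *)
have beta_succ i : (beta i.+1 - beta i = a`_(i.+1 %% M))%R.
  rewrite /beta (_ : i.+1 %% M = (i %% M).+1 %% M); last by rewrite -addn1 -modnDml addn1.
  have := ltn_pmod i M0; rewrite leq_eqVlt => /orP [/eqP ->|ltSi].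
    by rewrite modnn big_ord_recl big_ord0 addr0 sum0 subr0.
  by rewrite modn_small // big_ord_recr /= addrAC subrr add0r.
(* The index moves by one because [beta i] already includes the term [i] of [a]. *)
have lempelE i : Lempel (window beta n.+1 i) = cwindow a n i.+1.
  apply: eq_from_nth0 => j ltj; have ltj' : j < n.+1 by apply: ltnW.
  rewrite nth_Lempel // !nth_window // addnS beta_succ.
  by rewrite /cwindow nth_tuple_of addSn.
have cwH i : all (@in_0half k) (cwindow a n i).
  apply/allP => x /tnthP [j ->]; rewrite tnth_mktuple; apply: aH.
  by rewrite mem_nth // size_tuple ltn_pmod.
exists M, beta; split.
  split=> //.
  - by move=> i; rewrite /beta modnDr.
  - by move=> i; rewrite /beta -sumrN; apply: eq_bigr => j _.
  - move=> i j lti ltj; rewrite !lempelE -(cwindow_mod a n i.+1) -(cwindow_mod a n j.+1) => eqw.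
    have [l [_ uniq_l]] := a_uniq _ (cwH (i.+1 %% M)).
    have := uniq_l (Ordinal (ltn_pmod i.+1 M0)) erefl.
    rewrite (uniq_l (Ordinal (ltn_pmod j.+1 M0)) (esym eqw)) => /(congr1 val) /=.
    move/eqP; rewrite -(addn1 i) -(addn1 j) eqn_modDr !modn_small //.
    by move/eqP.
  move=> t /eqP; rewrite -all_in_0half // => /a_uniq [i [<- _]].
  (* Adding [M.-1] steps back by one modulo [M], compensating for the shift in [lempelE]. *)
  exists (i + M.-1); rewrite lempelE -addnS prednK // -cwindow_mod modnDr.
  by rewrite cwindow_mod.
move=> x e; rewrite /bcircuit (negPf k_even).
have wE i : window (fun m => x + beta m)%R n.+1 i = cwindow (Defs.bseq a x) n.+1 i.
  apply: eq_from_nth0 => j ltj; rewrite nth_window // /cwindow nth_tuple_of.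
  by rewrite /Defs.bseq nth_tuple_of ?ltn_pmod.
split=> [/imsetP [i _ ->]|[i ->]]; first by exists i; rewrite wE.
apply/imsetP; exists (Ordinal (ltn_pmod i M0)) => //; rewrite wE.
by rewrite -cwindow_mod.
Qed.

(** * The graph Z_k(n) and the maximal sequence *)

Lemma edges_Zgraph k n (P : {set {set n.-tuple 'Z_k}}) (a : (2 ^ n).-tuple 'Z_k) M beta :
  2 < k -> tail_sequence n M beta ->
  (forall x e, e \in bcircuit a x <->
               exists i, e = window (fun m => x + beta m)%R n.+1 i) ->
  edges (Zgraph P a) =
    [set e : n.+1.-tuple 'Z_k | Lempel e \in Fset P] :|: tail_edges n M beta.
Proof.
move=> k2 tailb bP; congr (_ :|: _); apply/setP => e.
apply/bigcupP/(tail_edgesP tailb) => [[x /andP [x0 xk] /bP [i ->]]|].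
  by exists x, i.
move=> [x [i [x0 xk ->]]].
have ltxk : x < k by apply: leq_ltn_trans xk; rewrite -addnn leq_addr.
exists (Ordinal ltxk); first by rewrite /= x0.
by apply/bP; exists i.
Qed.

Theorem theorem7p2 (k n : nat) (hk : 3 <= k) (hn : 3 <= n) (n_odd : odd n) :
  (forall (P : {set {set n.-tuple 'Z_k}}) (a : (2 ^ n).-tuple 'Z_k),
     circuit_choice P -> (~~ odd k -> T_circuit a) ->
     subgraph (Zgraph P a) (deBruijn k n) /\ eulerian (Zgraph P a)) /\
  (exists s : nat -> 'Z_k, maximal_NAS n.+1 s).
Proof.
have k1 : 1 < k by apply: ltnW.
have n1 : 1 < n by apply: ltnW.
have n0 : 0 < n by apply: ltnW.
split=> [P a choiceP aT|].
  have [M [beta [tailb bP]]] := bcircuit_tail_sequence k1 n1 aT.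
  have ZE := edges_Zgraph P hk tailb bP; split.
    split=> [||e eZ]; [exact: subsetT | exact: subsetT |].
    by rewrite !inE !imset_f ?orbT.
  by rewrite /Zgraph -[_ :|: _]/(edges (Zgraph P a)) ZE; apply: eulerian_Z.
have [P choiceP] := circuit_choice_exists k1 n_odd.
have [a aT] : exists a : (2 ^ n).-tuple 'Z_k, ~~ odd k -> T_circuit a.
  have [k_odd|k_even] := boolP (odd k); first by exists [tuple 0%R | _ < 2 ^ n].
  by have [a aT] := T_circuit_exists k1 k_even n0; exists a.
have [M [beta [tailb _]]] := bcircuit_tail_sequence k1 n1 aT.
set Z := [set e : n.+1.-tuple 'Z_k | Lempel e \in Fset P] :|: tail_edges n M beta.
have eulZ : eulerian (edge_graph Z) by apply: eulerian_Z.
have cardZ : #|Z| = max_period k n.+1.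
  have := card_Z hk n0 choiceP tailb; rewrite -/Z card_self_negative // /max_period.
  by case: ifP => _ <-; rewrite addnK -muln2 mulnK.
have Z0 : Z != set0.
  (* The constant tuple 1 is not self-negative, so it or its negative lies in [Z]. *)
  pose e : n.+1.-tuple 'Z_k := [tuple 1%R | _ < n.+1].
  have ne : negt e != e.
    apply: contraNneq (oppr1_Zp_neq1 hk) => /(congr1 (fun t : n.+1.-tuple 'Z_k => t`_0)%R).
    by rewrite nth_negt nth_tuple_of // => ->.
  by apply/set0Pn; case/orP: (Z_complete hk n0 choiceP tailb ne); [exists e | exists (negt e)].
have [s [per sZ s_inj]] := eulerian_sequence Z0 eulZ; rewrite cardZ in per s_inj.
exists s; split; first split=> //; first by rewrite -cardZ card_gt0.
move=> t [i <-] [j sj]; have := Z_negt hk n0 choiceP tailb (sZ i).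
by rewrite -sj sZ.
Qed.
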